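(* Let $d$ be a nonnegative integer and let $0 < q < p \leq \infty$. Then for all $f \in \mathcal{B}_d(-1,1)$, $$\|f\|_p \leq \left( \frac{qd+1}{2} \right)^{1/q-1/p} \|f\|_q .$$ Equality holds only for $f(x) = c(1+x)^d$ or $f(x) = c(1-x)^d$ with a constant $c \geq 0$.
   Context: For a nonnegative integer $d$, $$\mathcal{B}_d(-1,1) := \left\{ f : f(x) = \sum_{j=0}^d a_j (1-x)^j (x+1)^{d-j}, \quad a_j \geq 0, \ j = 0,1,\ldots,d \right\}.$$ For $0 < p < \infty$, $\|f\|_p := \left( \int_{-1}^1 |f(x)|^p \, dx \right)^{1/p}$, and $\|f\|_{\infty} := \max_{x \in [-1,1]} |f(x)|$. When $p = \infty$, $1/p$ is interpreted as $0$. *)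

(* Defs.v *)
From mathcomp Require Import all_boot all_order all_algebra.
From mathcomp Require Import all_classical all_reals all_analysis.

Set Implicit Arguments.
Unset Strict Implicit.
Unset Printing Implicit Defensive.

Import Order.TTheory GRing.Theory Num.Theory.
Import numFieldNormedType.Exports.

Local Open Scope classical_set_scope.
Local Open Scope ring_scope.

(* Polynomial functions on the whole line: two of them that agree on [-1,1]
   agree everywhere, so nothing depends on this choice of domain. *)
Definition bernstein_cone (R : realType) (d : nat) : set (R -> R) :=
  [set f | exists2 a : 'I_d.+1 -> R, (forall j, 0 <= a j) &
    forall x, f x = \sum_(j < d.+1) a j * (1 - x) ^+ j * (x + 1) ^+ (d - j)].

(* The norm of the restriction of f to [-1,1]. At +oo it is the maximum (not the
   essential supremum), written with sup; see pnormy_max. The case -oo is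
   junk. *)
Definition pnorm (R : realType) (p : \bar R) (f : R -> R) : R :=
  match p with
  | r%:E => (\int[lebesgue_measure]_(x in `[(-1 : R), 1]) (`|f x| `^ r)) `^ r^-1
  | +oo%E => sup [set `|f x| | x in `[(-1 : R), 1]]
  | -oo%E => 0
  end.

Lemma pnormy_max (R : realType) (f : R -> R) :
  {within `[(-1 : R), 1], continuous f} ->
  exists2 c, c \in `[(-1 : R), 1] &
    pnorm +oo f = `|f c| /\ forall x, x \in `[(-1 : R), 1] -> `|f x| <= `|f c|.
Proof.
move=> cf.
have cnf : {within `[(-1 : R), 1], continuous (fun x => `|f x|)}.
  by move=> x; apply: continuous_comp; [exact: cf | exact: norm_continuous].
have [c cI cmax] := EVT_max (le_trans (lerN10 R) ler01) cnf.
exists c => //; split => //=.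
apply/eqP; rewrite eq_le; apply/andP; split.
- apply: ge_sup; first by exists `|f c|, c.
  by move=> _ [x xI <-]; exact: cmax.
- apply: ub_le_sup; last by exists c.
  by exists `|f c| => _ [x xI <-]; exact: cmax.
Qed.

(* Main.v *)
Require Import Defs.
From mathcomp Require Import all_boot all_order all_algebra.
From mathcomp Require Import all_classical all_reals all_analysis.
From mathcomp Require Import lra ring.

Import Order.TTheory GRing.Theory Num.Theory.
Import numFieldNormedType.Exports.

Local Open Scope classical_set_scope.
Local Open Scope ring_scope.

(* For f in the cone, f(x)/(1+x)^d is nonincreasing and f(x)/(1-x)^d is
   nondecreasing, termwise. Hence, if |f| attains its maximum M over [-1,1] at
   y, then f(x) >= M ((1+x)/(1+y))^d for x <= y and f(x) >= M ((1-x)/(1-y))^d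
   for x >= y. Integrating q-th powers on both sides of y gives
   M^q (1+y)/(qd+1) + M^q (1-y)/(qd+1) = 2 M^q/(qd+1) as a lower bound for
   the integral of f^q: this is the case p = oo, and the case p < oo follows
   from |f|^p <= M^(p-q) |f|^q. In case of equality, both one-sided estimates
   are equalities, whereas f(x)/(1+x)^d is strictly decreasing unless f is a
   multiple of (1+x)^d. *)

(** * Powers of [|1 + x|]: continuity and integrals *)

Lemma continuous_normr_powR {R : realType} (t : R) :
  0 < t -> continuous (fun x : R => `|x| `^ t).
Proof.
move=> t0 x; have [->|x0] := eqVneq x 0.
  apply/cvgrPdist_lt => e e0; rewrite normr0 powR0 ?gt_eqF//.
  near=> y; rewrite sub0r normrN ger0_norm ?powR_ge0//.
  have -> : e = (e `^ t^-1) `^ t by rewrite -powRrM mulVf ?gt_eqF// powRr1// ltW.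
  rewrite gt0_ltr_powR ?nnegrE ?powR_ge0//.
  near: y; apply: (@cvgr0_norm_lt _ _ _ _ _ id); last exact: powR_gt0.
  exact: cvg_id.
have cpow : {for `|x|, continuous (fun y : R => y `^ t)}.
  apply/differentiable_continuous/derivable1_diffP/derivable_powR.
  by rewrite in_itv/= andbT normr_gt0.
exact: (@cvg_comp _ _ _ _ (fun y : R => y `^ t) _ _ _
  (@norm_continuous _ _ x) cpow).
Unshelve. all: end_near. Qed.

Lemma continuous_1D {R : realType} : continuous (fun x : R => 1 + x).
Proof. by move=> x; apply: cvgD; [exact: cvg_cst|exact: cvg_id]. Qed.

Lemma continuous_powR_1D {R : realType} (s : R) :
  0 <= s -> continuous (fun x : R => `|1 + x| `^ s).
Proof.
rewrite le_eqVlt => /predU1P[<-|s0].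
  by under eq_fun do rewrite powRr0; exact: cst_continuous.
move=> x; exact: (cvg_comp _ _ (continuous_1D x)
  (continuous_normr_powR s s0 (1 + x))).
Qed.

Lemma continuous_integrable_itv {R : realType} {F : R -> R} (a b : R) :
  continuous F -> (@lebesgue_measure R).-integrable `[a, b] (EFin \o F).
Proof.
move=> cF; apply: continuous_compact_integrable; first exact: segment_compact.
exact: continuous_subspaceT.
Qed.

Lemma Rintegral_itv_split {R : realType} {F : R -> R} (a c b : R) :
  continuous F -> a <= c <= b ->
  \int[@lebesgue_measure R]_(x in `[a, b]) F x =
  \int[@lebesgue_measure R]_(x in `[a, c]) F x +
  \int[@lebesgue_measure R]_(x in `[c, b]) F x.
Proof.
move=> cF /andP[ac cb].
have iF u v := continuous_integrable_itv u v cF.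
rewrite -(Rintegral_itv_obnd_cbnd (r := c)).
  by rewrite -(@Rintegral_itvB _ _ (BLeft a) (BRight b)) ?bnd_simp// addrC subrK.
by apply: integrableS (iF c b) => //; apply: subset_itv; rewrite bnd_simp.
Qed.

Lemma Rintegral_powR_1D {R : realType} (s u v : R) : 0 <= s -> -1 <= u <= v ->
  \int[@lebesgue_measure R]_(x in `[u, v]) (`|1 + x| `^ s) =
  (`|1 + v| `^ (s + 1) - `|1 + u| `^ (s + 1)) / (s + 1).
Proof.
move=> s0 /andP[u1]; rewrite le_eqVlt => /predU1P[->|uv].
  by rewrite set_itv1 Rintegral_set1 subrr mul0r.
have s1 : 0 < s + 1 by lra.
have cs := continuous_powR_1D s s0.
have cF : continuous (fun x : R => `|1 + x| `^ (s + 1) / (s + 1)).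
  by move=> x; apply: cvgM; [apply: continuous_powR_1D; lra|exact: cvg_cst].
have dF x : x \in `]u, v[ ->
    is_derive x 1 (fun x : R => `|1 + x| `^ (s + 1) / (s + 1)) (`|1 + x| `^ s).
  rewrite in_itv/= => /andP[ux xv].
  have x0 : 0 < 1 + x by lra.
  have d1 : is_derive x 1 (fun x : R => (1 + x) `^ (s + 1) / (s + 1))
      (`|1 + x| `^ s).
    have dpow := is_derive1_powR (s + 1) x0.
    have dadd : is_derive x 1 (fun x : R => 1 + x) 1.
      have := is_deriveD (is_derive_cst (1 : R) x 1) (is_derive_id x 1).
      by rewrite add0r.
    have dc := @is_derive1_comp _ (fun y => y `^ (s + 1)) (fun x => 1 + x) x
      _ _ dpow dadd.
    have -> : (fun x : R => (1 + x) `^ (s + 1) / (s + 1)) =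
        (s + 1)^-1 *: ((fun y => y `^ (s + 1)) \o (fun x => 1 + x)).
      by apply/funext => y; rewrite mulrC.
    apply: is_derive_eq; rewrite -[_ *: _]/(_ * _).
    by rewrite addrK gtr0_norm// mulr1 mulrA mulVf ?gt_eqF// mul1r.
  apply: near_eq_is_derive d1.
  near=> y; rewrite gtr0_norm//.
  near: y.
  have := lt_nbhsr x0.
  by move=> /(continuous_1D x).
rewrite /Rintegral (@continuous_FTC2 _ _ (fun x => `|1 + x| `^ (s + 1) / (s + 1)))//.
- by rewrite -EFinB/= mulrBl.
- exact: continuous_subspaceT.
- split.
  + by move=> x /dF[].
  + exact/cvg_at_right_filter/cF.
  + exact/cvg_at_left_filter/cF.
- by move=> x /dF[_ <-]; rewrite derive1E.
Unshelve. all: end_near. Qed.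

(** * Integral bounds from a nonincreasing ratio [F x / (1 + x)^s] *)

(** The pointwise hypothesis is integrated in [x] with [z] fixed. Cross-multiplied forms avoid
    dividing by [1 + z], which may vanish. *)
Lemma le_Rintegral_powR_1D {R : realType} {F : R -> R} {s u v z : R} :
  continuous F -> 0 <= s -> -1 <= u <= v -> v <= z ->
  (forall x, u <= x <= v -> F z * `|1 + x| `^ s <= F x * `|1 + z| `^ s) ->
  F z * ((1 + v) `^ (s + 1) - (1 + u) `^ (s + 1)) / (s + 1) <=
  (1 + z) `^ s * \int[@lebesgue_measure R]_(x in `[u, v]) F x.
Proof.
move=> cF s0 uv vz H.
have -> : 1 + v = `|1 + v| by rewrite ger0_norm//; lra.
have -> : 1 + u = `|1 + u| by rewrite ger0_norm//; lra.
rewrite -mulrA -Rintegral_powR_1D//.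
have iF := continuous_integrable_itv u v cF.
have iG := continuous_integrable_itv u v (continuous_powR_1D s s0).
rewrite -!RintegralZl//; apply: le_Rintegral => //.
- by apply: continuous_integrable_itv => x; apply: cvgM;
    [exact: cvg_cst|exact: continuous_powR_1D].
- by apply: continuous_integrable_itv => x; apply: cvgM; [exact: cvg_cst|exact: cF].
- move=> x /=; rewrite in_itv/= => /H.
  have -> : `|1 + z| = 1 + z by rewrite ger0_norm//; lra.
  by rewrite [in X in _ <= X]mulrC.
Qed.

Lemma Rintegral_left_lb {R : realType} {F : R -> R} {s y : R} :
  continuous F -> 0 <= s -> -1 <= y ->
  (forall x, 0 <= F x) ->
  (forall x z, -1 <= x -> x <= z -> z <= y ->
    F z * `|1 + x| `^ s <= F x * `|1 + z| `^ s) ->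
  F y * (1 + y) / (s + 1) <= \int[@lebesgue_measure R]_(x in `[-1, y]) F x.
Proof.
move=> cF s0; rewrite le_eqVlt => /predU1P[<- F0 _|y1 F0 H].
  by rewrite subrr mulr0 mul0r; apply: Rintegral_ge0 => x _.
have y0 : 0 < (1 + y) `^ s by apply: powR_gt0; lra.
have ub : F y * ((1 + y) `^ (s + 1) - (1 + -1) `^ (s + 1)) / (s + 1) <=
    (1 + y) `^ s * \int[@lebesgue_measure R]_(x in `[-1, y]) F x.
  apply: le_Rintegral_powR_1D => //; first by rewrite lexx ltW.
  by move=> x /andP[? ?]; apply: H.
rewrite -(ler_pM2l y0); apply: le_trans ub.
rewrite subrr powR0 ?subr0; last by lra.
rewrite powRD ?powRr1; [|lra|by apply/implyP => _; apply/eqP; lra].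
by rewrite le_eqVlt; apply/orP; left; apply/eqP; ring.
Qed.

(** Strictness at the single point [w] suffices: bound the integral on [[-1, w]] by means of [F w]
    and on [[w, y]] by means of [F y]. The gain over the bound from [F y] alone is a positive
    multiple of the gap in the strict hypothesis at [w]. *)
Lemma Rintegral_left_lb_lt {R : realType} {F : R -> R} {s y w : R} :
  continuous F -> 0 <= s -> -1 < w < y ->
  (forall x, 0 <= F x) ->
  (forall x z, -1 <= x -> x <= z -> z <= y ->
    F z * `|1 + x| `^ s <= F x * `|1 + z| `^ s) ->
  F y * `|1 + w| `^ s < F w * `|1 + y| `^ s ->
  F y * (1 + y) / (s + 1) < \int[@lebesgue_measure R]_(x in `[-1, y]) F x.
Proof.
move=> cF s0 /andP[w1 wy] F0 H Hw.
have s1 : 0 < s + 1 by lra.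
have w1y : -1 <= w <= y by rewrite !ltW.
rewrite (Rintegral_itv_split _ _ _ cF w1y).
have lb1 : F w * (1 + w) / (s + 1) <= \int[@lebesgue_measure R]_(x in `[-1, w]) F x.
  apply: Rintegral_left_lb => //; first exact: ltW.
  by move=> x z ? ? ?; apply: H => //; lra.
have y0 : 0 < (1 + y) `^ s by apply: powR_gt0; lra.
have lb2 : F y * ((1 + y) `^ (s + 1) - (1 + w) `^ (s + 1)) / (s + 1) <=
    (1 + y) `^ s * \int[@lebesgue_measure R]_(x in `[w, y]) F x.
  apply: le_Rintegral_powR_1D => //.
  by move=> x /andP[? ?]; apply: H => //; lra.
rewrite -(ltr_pM2l y0) [X in _ < X]mulrDr.
apply: lt_le_trans (lerD (ler_wpM2l (ltW y0) lb1) lb2).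
have powD x : -1 < x -> (1 + x) `^ (s + 1) = (1 + x) `^ s * (1 + x).
  move=> x1.
  rewrite powRD ?powRr1//; [lra|by apply/implyP => _; apply/eqP; lra].
rewrite !powD//; last lra.
move: Hw; rewrite !gtr0_norm; [|lra..] => Hw.
rewrite !mulrA -mulrDl ltr_pM2r ?invr_gt0// -subr_gt0.
(* After clearing [s + 1], the terms in [F y * (1 + y)] cancel and only the gap at [w] remains. *)
rewrite (_ : _ - _ = (1 + w) * (F w * (1 + y) `^ s - F y * (1 + w) `^ s));
  last by ring.
by rewrite mulr_gt0//; lra.
Qed.

(** * Monotonicity of [f x / (1 + x)^d] on the cone *)

(** Splitting [(1 + x)^d] into powers [j] and [d - j] isolates a factor symmetric in [x] and [z].
    Comparing two terms then reduces to [(1 - z)(1 + x) <= (1 - x)(1 + z)], that is, to [x <= z]. *)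
Lemma bernstein_term_cross {R : realType} {d j : nat} (x z : R) : (j <= d)%N ->
  (1 - z) ^+ j * (z + 1) ^+ (d - j) * (1 + x) ^+ d =
  ((1 - z) * (1 + x)) ^+ j * ((1 + x) * (1 + z)) ^+ (d - j).
Proof.
move=> jd; rewrite (addrC z) !exprMn -{2}(subnKC jd) exprD; ring.
Qed.

Lemma bernstein_term_le {R : realType} {d j : nat} {x z : R} : (j <= d)%N ->
  -1 <= x -> x <= z -> z <= 1 ->
  (1 - z) ^+ j * (z + 1) ^+ (d - j) * (1 + x) ^+ d <=
  (1 - x) ^+ j * (x + 1) ^+ (d - j) * (1 + z) ^+ d.
Proof.
move=> jd x1 xz z1; rewrite !bernstein_term_cross//.
have [zx0 xz0] : 0 <= (1 - z) * (1 + x) /\ 0 <= (1 - x) * (1 + z).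
  by split; apply: mulr_ge0; lra.
rewrite [X in _ <= _ * X ^+ _]mulrC ler_wpM2r//.
  by rewrite exprn_ge0// mulr_ge0//; lra.
by rewrite lerXn2r ?nnegrE//; lra.
Qed.

Lemma bernstein_term_lt {R : realType} {d j : nat} {x z : R} : (0 < j <= d)%N ->
  -1 < x -> x < z -> z <= 1 ->
  (1 - z) ^+ j * (z + 1) ^+ (d - j) * (1 + x) ^+ d <
  (1 - x) ^+ j * (x + 1) ^+ (d - j) * (1 + z) ^+ d.
Proof.
move=> /andP[j0 jd] x1 xz z1; rewrite !bernstein_term_cross//.
have [zx0 xz0] : 0 <= (1 - z) * (1 + x) /\ 0 <= (1 - x) * (1 + z).
  by split; apply: mulr_ge0; lra.
rewrite [X in _ < _ * X ^+ _]mulrC ltr_pM2r.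
  by rewrite ltrXn2r -?lt0n//; lra.
by rewrite exprn_gt0// mulr_gt0//; lra.
Qed.

Lemma bernstein_ratio_le {R : realType} {d : nat} {f : R -> R} :
  bernstein_cone d f -> forall x z, -1 <= x -> x <= z -> z <= 1 ->
  f z * (1 + x) ^+ d <= f x * (1 + z) ^+ d.
Proof.
move=> [a a0 fE] x z x1 xz z1; rewrite !fE !mulr_suml; apply: ler_sum => j _.
rewrite -!mulrA ler_wpM2l// !mulrA.
by apply: bernstein_term_le => //; rewrite -ltnS.
Qed.

(** If only the coefficient of index 0 can be nonzero, [f] is a multiple of [(1 + x)^d]. Otherwise
    some term with [0 < j] has a positive coefficient, and it makes the termwise comparison
    strict. *)
Lemma bernstein_ratio_lt {R : realType} {d : nat} {f : R -> R} :
  bernstein_cone d f ->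
  (exists2 c, 0 <= c & forall x, f x = c * (1 + x) ^+ d) \/
  forall x z, -1 < x -> x < z -> z <= 1 ->
    f z * (1 + x) ^+ d < f x * (1 + z) ^+ d.
Proof.
move=> [a a0 fE].
have [/forallP aE|/forallPn[j]] := boolP [forall j, (j != ord0) ==> (a j == 0)].
  left; exists (a ord0) => // x.
  rewrite fE big_ord_recl/= big1 => [|i _].
    by rewrite addr0 expr0 mulr1 subn0 addrC.
  have /implyP/(_ isT)/eqP -> := aE (lift ord0 i).
  by rewrite !mul0r.
rewrite negb_imply => /andP[j0 aj]; right => x z x1 xz z1.
rewrite !fE !mulr_suml (bigD1 j)//= [ltRHS](bigD1 j)//= ltr_leD//.
  have aj0 : 0 < a j by rewrite lt_neqAle eq_sym aj a0.
  rewrite -!mulrA ltr_pM2l// !mulrA.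
  by apply: bernstein_term_lt => //; rewrite lt0n -ltnS ltn_ord andbT.
apply: ler_sum => i _; rewrite -!mulrA ler_wpM2l// !mulrA.
by apply: bernstein_term_le; rewrite -1?ltnS// ltW.
Qed.

(** * Reflection, continuity and positivity on the cone *)

(** Reflection exchanges [1 - x] and [1 + x], hence reverses the coefficients. It turns estimates to
    the left of a point into estimates to the right. *)
Lemma bernstein_cone_oppr {R : realType} {d : nat} {f : R -> R} :
  bernstein_cone d f -> bernstein_cone d (f \o -%R).
Proof.
move=> [a a0 fE]; exists (fun j => a (rev_ord j)) => [j|x /=]; first exact: a0.
rewrite fE (reindex_inj rev_ord_inj)/=; apply: eq_bigr => j _.
have jd : (j <= d)%N by rewrite -ltnS.
rewrite subSS subKn// opprK -!mulrA; congr *%R.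
by rewrite mulrC (addrC (- x)) (addrC 1 x).
Qed.

Lemma bernstein_cone_continuous {R : realType} {d : nat} {f : R -> R} :
  bernstein_cone d f -> continuous f.
Proof.
move=> [a _ /funext ->]; apply: continuous_big => [|j _ x].
  exact: add_continuous.
apply: cvgM; last first.
  apply: (@cvg_comp _ _ _ (fun x : R => x + 1) (fun x => x ^+ (d - j))).
    by apply: cvgD; [exact: cvg_id|exact: cvg_cst].
  exact: exprn_continuous.
apply: cvgM; first exact: cvg_cst.
apply: (@cvg_comp _ _ _ (fun x : R => 1 - x) (fun x => x ^+ j)).
  by apply: cvgB; [exact: cvg_cst|exact: cvg_id].
exact: exprn_continuous.
Qed.

Lemma bernstein_cone_ge0 {R : realType} {d : nat} {f : R -> R} :
  bernstein_cone d f -> forall x, -1 <= x <= 1 -> 0 <= f x.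
Proof.
move=> [a a0 fE] x x1; rewrite fE; apply: sumr_ge0 => j _.
by rewrite !mulr_ge0// exprn_ge0//; lra.
Qed.

(** * One-sided bounds for the integral of [|f|^q] *)

Lemma continuous_normr_powR_comp {R : realType} {f : R -> R} (q : R) :
  0 < q -> continuous f -> continuous (fun x => `|f x| `^ q).
Proof.
move=> q0 cf x; exact: (cvg_comp _ _ (cf x) (continuous_normr_powR q q0 (f x))).
Qed.

Lemma exprn_powR {R : realType} {q x : R} (d : nat) : 0 <= x ->
  (x ^+ d) `^ q = x `^ (q * d%:R).
Proof. by move=> x0; rewrite mulrC powRrM powR_mulrn. Qed.

(** The ratio of [|f|^q] to [(1 + x)^(q d)] is the [q]-th power of the monotone ratio for [f], so
    the integral bounds apply with [s = q d]. At [y = -1] equality reads [0 = 0] and says nothing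
    about [f], hence the condition [-1 < y]. *)
Lemma bernstein_left_lb {R : realType} {d : nat} {f : R -> R} {q y : R} :
  0 < q -> bernstein_cone d f -> -1 <= y <= 1 ->
  `|f y| `^ q * (1 + y) / (q * d%:R + 1) <=
    \int[@lebesgue_measure R]_(x in `[-1, y]) (`|f x| `^ q) /\
  (`|f y| `^ q * (1 + y) / (q * d%:R + 1) =
    \int[@lebesgue_measure R]_(x in `[-1, y]) (`|f x| `^ q) ->
   -1 < y -> exists2 c, 0 <= c & forall x, f x = c * (1 + x) ^+ d).
Proof.
move=> q0 fB /andP[y1 y1'].
have s0 : 0 <= q * d%:R by rewrite mulr_ge0// ltW.
have cF := continuous_normr_powR_comp q q0 (bernstein_cone_continuous fB).
have F0 x : 0 <= `|f x| `^ q by exact: powR_ge0.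
have powE x z : -1 <= x <= 1 -> -1 <= z <= 1 ->
    `|f z| `^ q * `|1 + x| `^ (q * d%:R) = (f z * (1 + x) ^+ d) `^ q.
  move=> x1 z1.
  have fz := bernstein_cone_ge0 fB z z1.
  have x0 : 0 <= 1 + x by lra.
  by rewrite powRM ?exprn_ge0// exprn_powR// !ger0_norm.
have H x z : -1 <= x -> x <= z -> z <= y ->
    `|f z| `^ q * `|1 + x| `^ (q * d%:R) <= `|f x| `^ q * `|1 + z| `^ (q * d%:R).
  move=> x1 xz zy.
  have [xI zI] : -1 <= x <= 1 /\ -1 <= z <= 1 by split; lra.
  rewrite !powE// ge0_ler_powR ?nnegrE ?(ltW q0)//.
  - by rewrite mulr_ge0 ?(bernstein_cone_ge0 fB) ?exprn_ge0//; lra.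
  - by rewrite mulr_ge0 ?(bernstein_cone_ge0 fB) ?exprn_ge0//; lra.
  - by apply: (bernstein_ratio_le fB) => //; lra.
split; first exact: (Rintegral_left_lb cF s0 y1 F0 H).
move=> eqI yN1; case: (bernstein_ratio_lt fB) => // H'; exfalso.
(* The midpoint of [-1] and [y]; any interior point would do. *)
pose w := (y - 1) / 2.
have wI : -1 < w < y by rewrite /w; lra.
suff /(Rintegral_left_lb_lt cF s0 wI F0 H) : `|f y| `^ q * `|1 + w| `^ (q * d%:R) <
    `|f w| `^ q * `|1 + y| `^ (q * d%:R) by rewrite eqI ltxx.
rewrite !powE; [|lra..].
rewrite gt0_ltr_powR ?nnegrE//.
- by rewrite mulr_ge0 ?(bernstein_cone_ge0 fB) ?exprn_ge0//; lra.
- by rewrite mulr_ge0 ?(bernstein_cone_ge0 fB) ?exprn_ge0//; lra.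
- by apply: H'; lra.
Qed.

Lemma Rintegral_oppr {R : realType} {F : R -> R} (a b : R) :
  continuous F -> a <= b ->
  \int[@lebesgue_measure R]_(x in `[a, b]) F (- x) =
  \int[@lebesgue_measure R]_(x in `[- b, - a]) F x.
Proof.
move=> cF ab; rewrite /Rintegral integration_by_substitution_oppr//.
exact: continuous_subspaceT.
Qed.

Lemma bernstein_right_lb {R : realType} {d : nat} {f : R -> R} {q y : R} :
  0 < q -> bernstein_cone d f -> -1 <= y <= 1 ->
  `|f y| `^ q * (1 - y) / (q * d%:R + 1) <=
    \int[@lebesgue_measure R]_(x in `[y, 1]) (`|f x| `^ q) /\
  (`|f y| `^ q * (1 - y) / (q * d%:R + 1) =
    \int[@lebesgue_measure R]_(x in `[y, 1]) (`|f x| `^ q) ->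
   y < 1 -> exists2 c, 0 <= c & forall x, f x = c * (1 - x) ^+ d).
Proof.
move=> q0 fB y1.
have y1N : -1 <= - y <= 1 by lra.
have [/=] := bernstein_left_lb q0 (bernstein_cone_oppr fB) y1N.
have cF := continuous_normr_powR_comp q q0 (bernstein_cone_continuous fB).
rewrite (Rintegral_oppr _ _ cF); last lra.
rewrite !opprK => lb eq1; split => // /eq1 + y1'.
have {}y1' : -1 < - y by lra.
move=> /(_ y1')[c c0 fE]; exists c => // x.
by rewrite -[in LHS](opprK x) fE.
Qed.

(** * The two-sided bound, which gives the case [p = +oo] *)

Lemma bernstein_max_powR_le {R : realType} {d : nat} {f : R -> R} {q y : R} :
  0 < q -> bernstein_cone d f -> -1 <= y <= 1 ->
  `|f y| `^ q <= (q * d%:R + 1) / 2 *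
    \int[@lebesgue_measure R]_(x in `[-1, 1]) (`|f x| `^ q) /\
  (`|f y| `^ q = (q * d%:R + 1) / 2 *
    \int[@lebesgue_measure R]_(x in `[-1, 1]) (`|f x| `^ q) ->
   exists2 c : R, 0 <= c &
     (forall x, f x = c * (1 + x) ^+ d) \/ (forall x, f x = c * (1 - x) ^+ d)).
Proof.
move=> q0 fB yI.
have [] := bernstein_left_lb q0 fB yI.
have [] := bernstein_right_lb q0 fB yI.
have cF := continuous_normr_powR_comp q q0 (bernstein_cone_continuous fB).
rewrite (Rintegral_itv_split _ _ _ cF yI).
have s1 : 0 < q * d%:R + 1 by rewrite ltr_wpDl// mulr_ge0// ltW.
move: (\int[_]_(x in _) _) => I1 lb1 eq1.
move: (\int[_]_(x in _) _) => I2 lb2 eq2.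
rewrite ler_pdivrMr// in lb1; rewrite ler_pdivrMr// in lb2.
split; first by lra.
(* Equality in the sum of two inequalities forces equality in each. *)
move=> e; have e1 : `|f y| `^ q * (1 - y) / (q * d%:R + 1) = I1.
  by apply: (canLR (mulfK (lt0r_neq0 s1))); lra.
have e2 : `|f y| `^ q * (1 + y) / (q * d%:R + 1) = I2.
  by apply: (canLR (mulfK (lt0r_neq0 s1))); lra.
(* At least one of [-1 < y] and [y < 1] holds, so at least one equality case is informative. *)
have [yN1|yN1] := ltP (-1) y.
  by have [c c0 fE] := eq2 e2 yN1; exists c => //; left.
have y1 : y < 1 by lra.
by have [c c0 fE] := eq1 e1 y1; exists c => //; right.
Qed.

(** * From the maximum to finite exponents *)

(** Here [I] and [J] stand for the integrals of [|f|^q] and [|f|^r], [m] for the maximum of [|f|^q],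
    and [K] for [(q d + 1) / 2]. The bound is the [r]-th root of
    [J <= m^(r/q - 1) I <= (K I)^(r/q - 1) I]. *)
Lemma powR_interpolation {R : realType} {q r K I J m : R} :
  0 < q < r -> 0 <= K -> 0 <= I -> 0 <= J -> 0 <= m ->
  m <= K * I -> J <= m `^ (r / q - 1) * I ->
  J `^ r^-1 <= K `^ (q^-1 - r^-1) * I `^ q^-1 /\
  (J `^ r^-1 = K `^ (q^-1 - r^-1) * I `^ q^-1 -> m = K * I).
Proof.
move=> /andP[q0 qr] K0 I0 J0 m0 mKI JmI.
have r0 : 0 < r by exact: lt_trans qr.
have t0 : 0 < r / q - 1 by rewrite subr_gt0 ltr_pdivlMr// mul1r.
have -> : K `^ (q^-1 - r^-1) * I `^ q^-1 = ((K * I) `^ (r / q - 1) * I) `^ r^-1.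
  rewrite (powRM _ K0 I0) -mulrA [_ * I]mulrC mulr_powRB1 ?divr_gt0//.
  rewrite powRM ?powR_ge0// -!powRrM.
  by congr (_ `^ _ * _ `^ _); field; rewrite !gt_eqF.
have KIt : m `^ (r / q - 1) * I <= (K * I) `^ (r / q - 1) * I.
  by rewrite ler_wpM2r// ge0_ler_powR ?nnegrE ?mulr_ge0// ltW.
split.
  rewrite ge0_ler_powR ?nnegrE ?invr_ge0 ?(ltW r0) ?mulr_ge0 ?powR_ge0//.
  exact: le_trans KIt.
move=> /powR_injective; rewrite invr_gt0 !nnegrE mulr_ge0 ?powR_ge0//.
move=> /(_ r0 J0 isT) JE.
apply/eqP; rewrite eq_le mKI/=.
have [->|In0] := eqVneq I 0; first by rewrite mulr0.
have {In0}I1 : 0 < I by rewrite lt_neqAle eq_sym In0.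
(* For [0 < I], a strict [m < K * I] would make the second inequality of the chain strict. *)
rewrite leNgt; apply/negP => mlt.
move: JmI; rewrite JE ler_pM2r// leNgt => /negP; apply.
by rewrite gt0_ltr_powR ?nnegrE// mulr_ge0// ltW.
Qed.

(** Bound the factor [|f x|^(r - q)] of [|f x|^r] by its value at [y]. That value is written as a
    power of [|f y|^q], the quantity controlled by the two-sided bound. *)
Lemma Rintegral_powR_le {R : realType} {f : R -> R} {q r y : R} :
  0 < q < r -> continuous f ->
  (forall x, -1 <= x <= 1 -> `|f x| <= `|f y|) ->
  \int[@lebesgue_measure R]_(x in `[-1, 1]) (`|f x| `^ r) <=
  (`|f y| `^ q) `^ (r / q - 1) *
    \int[@lebesgue_measure R]_(x in `[-1, 1]) (`|f x| `^ q).
Proof.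
move=> /andP[q0 qr] cf fy.
have r0 : 0 < r by exact: lt_trans qr.
have cF t (t0 : 0 < t) := continuous_normr_powR_comp t t0 cf.
rewrite -RintegralZl//; last exact/continuous_integrable_itv/cF.
apply: le_Rintegral => //.
- exact/continuous_integrable_itv/cF.
- by apply: continuous_integrable_itv => x; apply: cvgM; [exact: cvg_cst|exact: cF].
move=> x /=; rewrite in_itv/= => /fy fxy.
have -> : `|f x| `^ r = `|f x| `^ (r - q) * `|f x| `^ q.
  by rewrite -powRD subrK// gt_eqF.
rewrite -powRrM (_ : q * _ = r - q); last by field; rewrite gt_eqF.
by rewrite ler_wpM2r ?powR_ge0// ge0_ler_powR ?nnegrE//; lra.
Qed.

(** * The inequality and its equality case for all [p] *)

Theorem theorem2p1 (R : realType) (d : nat) (q : R) (p : \bar R)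
    (q_gt0 : 0 < q) (q_lt_p : (q%:E < p)%E)
    (f : R -> R) (fB : bernstein_cone d f) :
  pnorm p f <= ((q * d%:R + 1) / 2) `^ (q^-1 - fine (p^-1)%E) * pnorm q%:E f
  /\
  (pnorm p f = ((q * d%:R + 1) / 2) `^ (q^-1 - fine (p^-1)%E) * pnorm q%:E f ->
   exists2 c : R, 0 <= c &
     (forall x, f x = c * (1 + x) ^+ d) \/ (forall x, f x = c * (1 - x) ^+ d)).
Proof.
have cf := bernstein_cone_continuous fB.
have [y yI [normfE fy]] := pnormy_max (continuous_subspaceT cf).
rewrite in_itv/= in yI.
have [max_le max_eq] := bernstein_max_powR_le q_gt0 fB yI.
have K0 : 0 <= (q * d%:R + 1) / 2.
  by rewrite divr_ge0// addr_ge0// mulr_ge0// ltW.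
have I0 : 0 <= \int[@lebesgue_measure R]_(x in `[-1, 1]) (`|f x| `^ q).
  by apply: Rintegral_ge0 => x _; exact: powR_ge0.
case: p q_lt_p => [r| |] //; rewrite ?lte_fin => qr.
  have qr' : 0 < q < r by rewrite q_gt0.
  have r0 : 0 < r by exact: lt_trans qr.
  have J0 : 0 <= \int[@lebesgue_measure R]_(x in `[-1, 1]) (`|f x| `^ r).
    by apply: Rintegral_ge0 => x _; exact: powR_ge0.
  rewrite inver (gt_eqF r0)/=.
  have [le_rq eq_rq] := powR_interpolation qr' K0 I0 J0 (powR_ge0 _ _) max_le
    (Rintegral_powR_le qr' cf fy).
  by split => // /eq_rq/max_eq.
(* For [p = +oo] the exponent is [q^-1], and the claim is the [q]-th root of the two-sided bound at
   the maximum point [y]. *)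
rewrite normfE invey/= subr0 -powRM//.
have {1 2}-> : `|f y| = (`|f y| `^ q) `^ q^-1.
  by rewrite -powRrM mulfV ?gt_eqF// powRr1.
have KI0 := mulr_ge0 K0 I0.
split; first by rewrite ge0_ler_powR ?nnegrE ?invr_ge0 ?powR_ge0 ?(ltW q_gt0).
move=> /powR_injective; rewrite invr_gt0 !nnegrE KI0 powR_ge0.
by move=> /(_ q_gt0 isT isT)/max_eq.
Qed.
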